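(* Let $K$ be a field, let $I\subset R=K[x_1,\ldots,x_n]$ with $n\geq 2$ be a monomial ideal, let $\mathfrak{m}=(x_1,\ldots,x_n)$, and let $$\mathcal{G}(I)=\{x_1^{r_{1,1}}\cdots x_n^{r_{1,n}},\ \ldots,\ x_1^{r_{k,1}}\cdots x_n^{r_{k,n}}\}$$ be such that there exist some $i\neq j$ with $1\leq i,j\leq n$ for which $$r_{1,i}\geq r_{2,i}\geq\cdots\geq r_{k,i}\quad\text{and}\quad r_{1,j}\geq r_{2,j}\geq\cdots\geq r_{k,j}.$$ Then $\mathfrak{m}\notin \mathrm{Ass}(R/I)$.
   Context: $\mathcal{G}(I)$ denotes the unique minimal set of monomial generators of the monomial ideal $I$. $\mathrm{Ass}(R/I)$ is the set of associated primes of $I$, i.e. the prime ideals of the form $(I:f)=\{r\in R\mid rf\in I\}$ with $f\in R$. *)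

(* Defs.v *)
From mathcomp Require Import all_boot all_algebra.
From mathcomp Require Import boolp classical_sets.
From mathcomp Require Import mpoly.

Set Implicit Arguments.
Unset Strict Implicit.
Unset Printing Implicit Defensive.

Import GRing.Theory.
Local Open Scope classical_set_scope.
Local Open Scope ring_scope.

Section Ideals.
Variable R : comNzRingType.
Implicit Types (I P S : set R) (f : R).

(* MathComp's [idealr_closed] is not used because it excludes the unit ideal
   and only covers boolean predicates. *)
Definition is_ideal I : Prop :=
  [/\ I 0, forall x y, I x -> I y -> I (x + y) & forall a x, I x -> I (a * x)].

Definition ideal_gen S : set R :=
  [set x | forall J : set R, is_ideal J -> S `<=` J -> J x].

Definition prime_ideal P : Prop :=
  [/\ is_ideal P, ~ P 1 & forall x y, P (x * y) -> P x \/ P y].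

Definition colon I f : set R := [set x | I (x * f)].

(* [Ass I] stands for Ass(R/I). *)
Definition Ass I : set (set R) :=
  [set P | prime_ideal P /\ exists f, P = colon I f].

End Ideals.

Section MonomialIdeals.
Variables (K : fieldType) (n : nat).
Implicit Types (I : set {mpoly K[n]}) (S G : set 'X_{1..n}).

(* Monomials are represented by their exponent vectors. *)
Definition monomial_gen S : set {mpoly K[n]} :=
  ideal_gen [set 'X_[m] | m in S].

Definition monomial_ideal I : Prop := exists S, I = monomial_gen S.

(* Minimality is with respect to inclusion. *)
Definition minimal_monomial_generators I G : Prop :=
  I = monomial_gen G /\
  forall S, S `<=` G -> I = monomial_gen S -> S = G.

Definition irrelevant_ideal : set {mpoly K[n]} :=
  ideal_gen (range (fun i : 'I_n => 'X_i : {mpoly K[n]})).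

End MonomialIdeals.

Arguments irrelevant_ideal : clear implicits.

(* Main.v *)
Require Import Defs.
From mathcomp Require Import all_boot all_algebra.
From mathcomp Require Import boolp classical_sets.
From mathcomp Require Import mpoly.

(** Suppose that the ideal of all variables were [colon I f].  As it does not
    contain 1, [f] is not in [I], so by [monomial_gen_msupp] some monomial
    [X^u] of [f] is not in [I], while each [X_k * X^u] is, being a monomial of
    [X_k * f] (lemma [Ass_irrelevant_corner]).  Hence some generator [X^a]
    divides [X_i * X^u] but not [X^u], which forces [a i = u i + 1] and
    [a j <= u j]; likewise some generator [X^b] has [b j = u j + 1] and
    [b i <= u i] ([dvd_mulX_ndvd]).  So [a i > b i] and [a j < b j], which
    cannot happen when one ordering of the generators makes both exponents
    nonincreasing. *)

Set Implicit Arguments.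
Unset Strict Implicit.
Unset Printing Implicit Defensive.

Local Open Scope classical_set_scope.

Import GRing.Theory.

Section IdealGen.
Variable R : comNzRingType.
Implicit Types S : set R.

Lemma ideal_gen_ideal S : is_ideal (ideal_gen S).
Proof.
split=> [J [J0 _ _] _ //|x y Sx Sy J idJ SJ|a x Sx J idJ SJ].
  by case: (idJ) => _ JD _; apply: JD; [apply: Sx | apply: Sy].
by case: (idJ) => _ _ JM; apply: JM; apply: Sx.
Qed.

Lemma sub_ideal_gen S : S `<=` ideal_gen S.
Proof. by move=> x Sx J _; apply. Qed.

End IdealGen.

Section MonomialIdeals.
Variables (K : fieldType) (n : nat).
Implicit Types (S : set 'X_{1..n}) (m u s : 'X_{1..n}) (p : {mpoly K[n]}).

(** Membership in a monomial ideal is decided monomial by monomial: the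
    polynomials satisfying the right-hand side form an ideal containing the
    generators, and conversely each term of such a polynomial is a multiple of
    a generator. *)
Lemma monomial_gen_msupp S p :
  monomial_gen S p <->
  (forall m, m \in msupp p -> exists2 s, S s & (s <= m)%MM).
Proof.
split=> [Sp|supp_p].
- pose J : set {mpoly K[n]} := [set q |
    forall m, m \in msupp q -> exists2 s, S s & (s <= m)%MM].
  apply: (Sp J); last first.
    by move=> _ [s Ss <-] m; rewrite msuppX inE => /eqP ->; exists s;
       last exact: lepm_refl.
  split=> [m|x y Jx Jy m|a x Jx m]; first by rewrite msupp0.
    by move/msuppD_le; rewrite mem_cat => /orP[/Jx|/Jy].
  move/msuppM_le/allpairsP=> [[m1 m2] /= [_ /Jx[s Ss le_s_m2] ->]].
  by exists s => //; apply: lepm_trans le_s_m2 (lem_addl _ _).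
- have [I0 ID IM] := ideal_gen_ideal [set ('X_[s] : {mpoly K[n]}) | s in S].
  rewrite (mpolyE p) big_seq; apply: big_ind => // m /supp_p[s Ss le_sm].
  rewrite -(submK le_sm) mpolyXD scalerAl.
  by apply: IM; apply: sub_ideal_gen; exists s.
Qed.

(** The monomial [u] gives a nonzero element of the socle of the quotient ring.
    Passing from an arbitrary polynomial witness to a monomial one is what makes the
    question combinatorial. *)
Lemma Ass_irrelevant_corner S :
  Ass (monomial_gen S) (irrelevant_ideal K n) ->
  exists u, (forall s, S s -> ~ (s <= u)%MM) /\
    forall k : 'I_n, exists2 s, S s & (s <= u + U_(k))%MM.
Proof.
move=> [[_ irr1 _] [f irrE]].
have Xf k : monomial_gen S ('X_k * f)%R.
  suff: colon (monomial_gen S) f 'X_k by [].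
  by rewrite -irrE; apply: sub_ideal_gen; exists k.
have nSf : ~ monomial_gen S f.
  by move=> Sf; apply: irr1; rewrite irrE /colon /= mul1r.
have [no_u|] := pselect (forall m, m \in msupp f ->
    exists2 s, S s & (s <= m)%MM).
  by case: nSf; apply/monomial_gen_msupp.
move=> /existsNP[u /not_implyP[supp_u ndvd_u]]; exists u; split=> [s Ss le_su|k].
  by apply: ndvd_u; exists s.
apply: (monomial_gen_msupp S _).1 (Xf k) _ _.
by rewrite mulrC mcoeff_msupp addmC mcoeffMX -mcoeff_msupp.
Qed.

End MonomialIdeals.

Lemma dvd_mulX_ndvd n (s u : 'X_{1..n}) (i : 'I_n) :
  (s <= u + U_(i))%MM -> ~ (s <= u)%MM ->
  u i < s i /\ forall j, i <> j -> s j <= u j.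
Proof.
move=> /mnm_lepP le_s ndvd.
have le_sj j : i <> j -> s j <= u j.
  by move=> /eqP/negPf ij; have:= le_s j; rewrite mnmDE mnm1E ij addn0.
split=> //; rewrite ltnNge; apply/negP => le_si; apply: ndvd.
by apply/mnm_lepP => j; have [<- //|/eqP] := eqVneq i j; apply: le_sj.
Qed.

(** Both keys follow the positions in [r]: if [a] comes first then [g b <= g a],
    and [b] cannot come first, since [f] would then give [f a <= f b]. *)
Lemma sorted_geq2_not_opposite (T : eqType) (f g : T -> nat) (r : seq T) a b :
  sorted geq (map f r) -> sorted geq (map g r) ->
  a \in r -> b \in r -> f b < f a -> g b <= g a.
Proof.
rewrite !sorted_map => sf sg ar br lt_f.
have geq_homo h : sorted (relpre h geq) r -> forall x y, x \in r -> y \in r ->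
    index x r <= index y r -> h y <= h x.
  move=> sh x y xr yr le_xy; have := sorted_leq_nth _ _ x sh.
  move=> /(_ (fun _ _ _ xy yz => leq_trans yz xy) (fun _ => leqnn _)).
  move=> /(_ (index x r) (index y r)); rewrite !inE !index_mem.
  by move=> /(_ xr yr le_xy) /=; rewrite !nth_index.
have [le_ab|/ltnW le_ba] := leqP (index a r) (index b r); first exact: geq_homo.
by have := geq_homo f sf _ _ br ar le_ba; rewrite leqNgt lt_f.
Qed.

Theorem theorem3p7 (K : fieldType) (n : nat) (hn : (2 <= n)%N)
    (I : set {mpoly K[n]}) (hI : monomial_ideal I)
    (r : seq 'X_{1..n}) (hr : minimal_monomial_generators I [set` r])
    (i j : 'I_n) (hij : i <> j)
    (hi : sorted geq [seq (m : 'X_{1..n}) i | m <- r])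
    (hj : sorted geq [seq (m : 'X_{1..n}) j | m <- r]) :
  ~ Ass I (irrelevant_ideal K n).
Proof.
case: hr => -> _ /Ass_irrelevant_corner[u [ndvd_u dvd_uX]].
have [a ra /dvd_mulX_ndvd/(_ (ndvd_u a ra))[lt_uai le_au]] := dvd_uX i.
have [b rb /dvd_mulX_ndvd/(_ (ndvd_u b rb))[lt_ubj le_bu]] := dvd_uX j.
have lt_ba : b i < a i by apply: leq_ltn_trans lt_uai; apply/le_bu/nesym.
have := sorted_geq2_not_opposite hi hj ra rb lt_ba.
by rewrite leqNgt (leq_ltn_trans (le_au j hij) lt_ubj).
Qed.
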